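(* Let $G$ be a bridgeless non-bipartite cubic graph and let $g$ be its odd-girth. Then $$\phi_{\mathbb{C}}(G) \geq \begin{cases} 1 + 2\sin\left(\frac{\pi}{6}\cdot\frac{g}{g-1}\right) & \text{if } g \equiv 1 \text{ or } 3 \pmod 6,\\ 1 + 2\sin\left(\frac{\pi}{6}\cdot\frac{g+1}{g}\right) & \text{if } g \equiv 5 \pmod 6.\end{cases}$$
   Context: The odd-girth of a non-bipartite graph is the length of a shortest odd cycle in it. For a real number $r \geq 2$, a complex nowhere-zero $r$-flow on a graph $G$ is an orientation of $G$ together with a map $\varphi\colon E(G)\to\mathbb{C}$ such that $1 \le |\varphi(e)| \le r-1$ for every edge $e$ and, at every vertex, the sum of the values on incoming edges equals the sum of the values on outgoing edges. For a bridgeless graph $G$, the complex flow number $\phi_{\mathbb{C}}(G)$ is the minimum (equivalently infimum; it is attained) of the real numbers $r\ge 2$ such that $G$ admits a complex nowhere-zero $r$-flow. *)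

(* Defs.v *)
From HB Require Import structures.
From mathcomp Require Import all_boot all_order all_algebra.
From mathcomp Require Import complex.
From mathcomp Require Import reals trigo.
Set Implicit Arguments. Unset Strict Implicit. Unset Printing Implicit Defensive.
Import Order.TTheory GRing.Theory Num.Theory.
Local Open Scope ring_scope.

(* A finite multigraph: vertex type V, edge type E, each edge has an
   (unordered) pair of ends, recorded as (end1 e, end2 e). Loops and
   parallel edges are allowed by the data structure. *)
Record multigraph := MultiGraph {
  gV : finType;
  gE : finType;
  end1 : gE -> gV;
  end2 : gE -> gV
}.

Section Graphs.
Variable G : multigraph.
Local Notation V := (gV G).
Local Notation E := (gE G).

(* number of edge-ends at v (a loop counts twice) *)
Definition degree (v : V) : nat :=
  #|[set e : E | end1 e == v]| + #|[set e : E | end2 e == v]|.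

Definition cubic : Prop := forall v : V, degree v = 3%N.

Definition joins (e : E) (x y : V) : bool :=
  ((end1 e == x) && (end2 e == y)) || ((end1 e == y) && (end2 e == x)).

Definition adj_minus (e : E) : rel V :=
  fun x y => [exists f : E, (f != e) && joins f x y].

Definition is_bridge (e : E) : Prop := ~~ connect (adj_minus e) (end1 e) (end2 e).

Definition bridgeless : Prop := forall e : E, ~ is_bridge e.

Definition bipartite : Prop :=
  exists c : V -> bool, forall e : E, c (end1 e) != c (end2 e).

Definition has_cycle_of_length (k : nat) : Prop :=
  (0 < k)%N /\
  exists (vs : nat -> V) (es : nat -> E),
    [/\ forall i j, (i < k)%N -> (j < k)%N -> vs i = vs j -> i = j,
        forall i j, (i < k)%N -> (j < k)%N -> es i = es j -> i = j &
        forall i, (i < k)%N -> joins (es i) (vs i) (vs (i.+1 %% k)%N)].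

Definition odd_girth (g : nat) : Prop :=
  [/\ odd g, has_cycle_of_length g &
      forall k, odd k -> has_cycle_of_length k -> (g <= k)%N].

Definition tail (o : E -> bool) (e : E) : V := if o e then end1 e else end2 e.
Definition head (o : E -> bool) (e : E) : V := if o e then end2 e else end1 e.

Definition complex_nz_flow (R : realType) (r : R) (o : E -> bool)
    (phi : E -> R[i]) : Prop :=
  (forall e : E, 1 <= `|phi e| <= ((r - 1)%:C)%C) /\
  (forall v : V, \sum_(e : E | head o e == v) phi e
                 = \sum_(e : E | tail o e == v) phi e).

Definition admits_complex_flow (R : realType) (r : R) : Prop :=
  2 <= r /\ exists (o : E -> bool) (phi : E -> R[i]), complex_nz_flow r o phi.

End Graphs.

(* Main.v *)
Require Import Defs.
From HB Require Import structures.
From mathcomp Require Import all_boot all_order all_algebra.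
From mathcomp Require Import complex.
From mathcomp Require Import reals trigo.
From mathcomp Require Import ring lra zify.
From mathcomp Require Import topology normedtype derive.
Import Order.TTheory GRing.Theory Num.Theory.
Import numFieldNormedType.Exports.
Local Open Scope ring_scope.

(** Let [X_0, ..., X_(g-1)] be the flow values along a shortest odd cycle. At
    each of its vertices the third edge carries [X_(i+1) - X_i], so [X_i],
    [X_(i+1)] and their difference form a triangle with sides in
    [[1, r - 1]]. Put [r - 1 = 2 sin (pi/6 + e)] and give a length
    [a = 2 sin (pi/6 + x)] the potential [x], which lies in [[0, e]]. The angle
    [gamma] between two consecutive values of potentials [x] and [y] satisfies
    [pi/3 - x - y <= gamma <= pi/3 + 2e - x - y]. The signed angles add up to a
    multiple of [2 pi], whereas the same sum with every angle replaced by
    [pi/3] is an odd multiple of [pi/3]. If both signs occur, there are at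
    least two sign changes around the cycle, where the potentials cancel, so
    the total deviation is at most [2 (g - 1) e]. If all signs agree, it is at
    most [2 g e], which suffices unless [g = 1] modulo 6; in that case the
    angles must all be small, and the sharper bound
    [4 sin (pi t / 6) sin (pi / (6 t)) <= 1] at [t = g / (g - 1)] excludes it. *)

(** * Trigonometric identities and estimates around [pi / 6] and [pi / 3] *)

Section Trigonometry.
Variable R : realType.
Implicit Types x y z e t a b : R.

(** With [s = sin (pi / 6)], the double angle formula gives [1 - 2 s^2 = s], whose only positive
    root is [1 / 2]. *)
Lemma sin_pi6 : sin (pi / 6) = 1 / 2 :> R.
Proof.
have pi0 := pi_gt0 R.
have s0 : 0 < sin (pi / 6 : R) by apply: sin_gt0_pihalf; lra.
have c2 : cos (pi / 6 + pi / 6) = sin (pi / 6) :> R.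
  by rewrite -cosBpihalf -cosN; congr (cos _); lra.
have := cos2Dsin2 (pi / 6 : R); move: c2; rewrite cosD; nra.
Qed.

Lemma cos_pi3 : cos (pi / 3) = 1 / 2 :> R.
Proof. by rewrite -sin_pi6 -cosBpihalf -cosN; congr (cos _); lra. Qed.

Definition sqrt3 : R := 2 * sin (pi / 3).

Lemma sqrt3_sqr : sqrt3 ^+ 2 = 3.
Proof. by have := cos2Dsin2 (pi / 3 : R); rewrite /sqrt3 cos_pi3; lra. Qed.

Lemma sqrt3_gt0 : 0 < sqrt3.
Proof.
by have pi0 := pi_gt0 R; rewrite mulr_gt0 //; apply: sin_gt0_pi; lra.
Qed.

Lemma cos_pi6 : 2 * cos (pi / 6) = sqrt3.
Proof.
by rewrite /sqrt3 -cosBpihalf -[cos (pi / 6)]cosN; congr (_ * cos _); lra.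
Qed.

Lemma sin_pi6D x : 2 * sin (pi / 6 + x) = cos x + sqrt3 * sin x.
Proof. by rewrite sinD -cos_pi6 sin_pi6; lra. Qed.

Lemma cos_pi3D x : 2 * cos (pi / 3 + x) = cos x - sqrt3 * sin x.
Proof. by rewrite cosD /sqrt3 cos_pi3; lra. Qed.

Lemma sin_MVT z : 0 <= z -> exists2 c, 0 <= c <= z & sin z = cos c * z.
Proof.
move=> z0.
have [|c cz] := @MVT_segment R sin cos 0 z z0 (fun x _ => is_derive_sin x).
  by apply: continuous_subspaceT; exact: continuous_sin.
by rewrite sin0 !subr0; exists c => //; move: cz; rewrite in_itv.
Qed.

Lemma sin_le_id z : 0 <= z -> sin z <= z.
Proof.
by move=> z0; have [c _ ->] := sin_MVT _ z0; have := cos_le1 c; nra.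
Qed.

Lemma pi_ge3 : 3 <= pi :> R.
Proof.
have pi0 := pi_gt0 R.
have : sin (pi / 6) <= pi / 6 :> R by apply: sin_le_id; lra.
by rewrite sin_pi6; lra.
Qed.

Lemma ler_cos x y : 0 <= x -> x <= y -> y <= pi -> cos y <= cos x.
Proof.
move=> x0 xy yp; rewrite leNgt ltr_cos ?in_itv /= -?leNgt //; apply/andP; split=> //; lra.
Qed.

Lemma mul_cos_le_sin z : 0 <= z <= pi -> z * cos z <= sin z.
Proof.
move=> /andP[z0 zp]; have [c /andP[c0 cz] ->] := sin_MVT _ z0.
by have := ler_cos _ _ c0 cz zp; nra.
Qed.

Lemma cos_half x : 1 - cos x = 2 * sin (x / 2) ^+ 2.
Proof.
rewrite {1}(_ : x = x / 2 + x / 2); last lra.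
by rewrite cosD; have := cos2Dsin2 (x / 2); lra.
Qed.

Lemma cos_ge_quadratic x : 0 <= x <= pi -> 1 - x ^+ 2 / 2 <= cos x.
Proof.
move=> /andP[x0 xp]; have h0 : 0 <= x / 2 by lra.
have := sin_le_id _ h0; have := cos_half x.
have : 0 <= sin (x / 2) by apply: sin_ge0_pi; lra.
nra.
Qed.

(** With the [u] and [z] below, the claim becomes [1 - cos u + sqrt3 sin u <= 4 sin^2 z]. Since
    [z^2 >= u / 2], the right-hand side is nearly [2 u] or more, and [2 > sqrt3] leaves room for the
    higher-order terms. *)
Lemma mul_sin_pi6_le1 g : 7 <= g ->
  4 * sin (pi / 6 * (g / (g - 1))) * sin (pi / 6 * ((g - 1) / g)) <= 1 :> R.
Proof.
move=> g7; have pi3 := pi_ge3; have pi4 : pi < 4 :> R by have := @pihalf_lt2 R; lra.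
pose x : R := pi / 6 / (g - 1); pose y : R := pi / 6 / g.
have g0 : g != 0 by rewrite gt_eqF //; lra.
have g1 : g - 1 != 0 by rewrite gt_eqF //; lra.
have xE : x * (g - 1) = pi / 6 by rewrite /x; field.
have yE : y * g = pi / 6 by rewrite /y; field.
have x0 : 0 < x by nra.
have y0 : 0 < y by nra.
have x9 : x <= 1 / 9 by nra.
have xyE : x * y = pi / 6 * (x - y) by rewrite /x /y; field; rewrite g0.
have xy : y < x by nra.
have -> : pi / 6 * (g / (g - 1)) = pi / 6 + x by rewrite /x; field.
have -> : pi / 6 * ((g - 1) / g) = pi / 6 + - y by rewrite /y; field.
pose u : R := x - y; pose z : R := (x + y) / 2.
have -> : 4 * sin (pi / 6 + x) * sin (pi / 6 + - y)
     = 2 * cos (z + z) - 2 * cos (pi / 3 + u).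
  have -> : z + z = (pi / 6 + x) - (pi / 6 + - y) by rewrite /z; field.
  have -> : pi / 3 + u = (pi / 6 + x) + (pi / 6 + - y) by rewrite /u; field.
  by move: (pi / 6 + x) (pi / 6 + - y) => A B; rewrite cosB cosD; ring.
rewrite cos_pi3D cosD.
have u0 : 0 < u by rewrite /u; lra.
have u9 : u <= 1 / 9 by rewrite /u; lra.
(* By AM-GM, [z^2 >= x y = (pi / 6) u], and [pi >= 3]. *)
have zu : u / 2 <= z ^+ 2 by rewrite /z /u; nra.
have z0 : 0 < z by rewrite /z; lra.
have z9 : z <= 1 / 9 by rewrite /z; lra.
have zz : z ^+ 2 <= 1 / 81 by nra.
have sz : z * (1 - z ^+ 2 / 2) <= sin z.
  apply: le_trans (mul_cos_le_sin _ _); last lra.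
  by rewrite ler_pM2l // cos_ge_quadratic //; lra.
have su : sin u <= u by apply/sin_le_id/ltW.
have cu : 1 - u ^+ 2 / 2 <= cos u by apply: cos_ge_quadratic; lra.
have s3 : sqrt3 <= 1733 / 1000 by have := sqrt3_sqr; have := sqrt3_gt0; nra.
have s30 := sqrt3_gt0.
have zcz := cos2Dsin2 z.
have sz2 : z ^+ 2 * (1 - z ^+ 2) <= sin z ^+ 2.
  have : (z * (1 - z ^+ 2 / 2)) ^+ 2 <= sin z ^+ 2 by rewrite ler_sqr ?nnegrE; nra.
  by nra.
have : sqrt3 * sin u <= 1733 / 1000 * u.
  have su0 : 0 <= sin u by apply: sin_ge0_pi; lra.
  by nra.
have : u * 80 / 81 <= 2 * sin z ^+ 2 by nra.
have : u ^+ 2 <= u / 9 by nra.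
move: cu zcz; set c := cos z; set s := sin z; nra.
Qed.

(* With [a = 2 sin (pi / 6 + x)] and [b = 2 sin (pi / 6 + y)], the left-hand
   side equals [1 - 8 cos (x + y) sin x sin y]. *)
Lemma cos_law_le1 x y : 0 <= x -> 0 <= y -> x + y <= pi / 2 ->
  (2 * sin (pi / 6 + x)) ^+ 2 + (2 * sin (pi / 6 + y)) ^+ 2
    - 2 * (2 * sin (pi / 6 + x)) * (2 * sin (pi / 6 + y)) * cos (pi / 3 - (x + y)) <= 1.
Proof.
move=> x0 y0 xy; have pi0 := pi_gt0 R.
have -> : (2 * sin (pi / 6 + x)) ^+ 2 + (2 * sin (pi / 6 + y)) ^+ 2
    - 2 * (2 * sin (pi / 6 + x)) * (2 * sin (pi / 6 + y)) * cos (pi / 3 - (x + y))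
  = 1 - 8 * cos (x + y) * sin x * sin y.
  rewrite !sin_pi6D -[2 * _ * _]mulrA [2 * _]mulrC -[_ * 2 * _]mulrA cos_pi3D cosN sinN.
  rewrite sinD cosD.
  by ring: sqrt3_sqr (cos2sin2 x) (cos2sin2 y).
have : 0 <= cos (x + y) * sin x * sin y.
  rewrite mulr_ge0 ?mulr_ge0 //; [apply: cos_ge0_pihalf|apply: sin_ge0_pi|apply: sin_ge0_pi]; lra.
lra.
Qed.

(* The right-hand side is [4 (P - k)^2 + 8 k P (1 - Q)] for the [k], [P], [Q]
   below, and [sin (pi / 6 + e) = cos e - k]. *)
Lemma cos_law_ge e x y : e <= pi / 6 -> 0 <= x <= e -> 0 <= y <= e ->
  (2 * sin (pi / 6 + e)) ^+ 2 <=
  (2 * sin (pi / 6 + x)) ^+ 2 + (2 * sin (pi / 6 + y)) ^+ 2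
    - 2 * (2 * sin (pi / 6 + x)) * (2 * sin (pi / 6 + y)) * cos (pi / 3 + (2 * e - (x + y))).
Proof.
move=> e6 /andP[x0 xe] /andP[y0 ye]; have pi0 := pi_gt0 R.
set k := cos (pi / 3 + e); set P := cos (x + y - e); set Q := cos (x - y).
have -> : (2 * sin (pi / 6 + x)) ^+ 2 + (2 * sin (pi / 6 + y)) ^+ 2
    - 2 * (2 * sin (pi / 6 + x)) * (2 * sin (pi / 6 + y)) * cos (pi / 3 + (2 * e - (x + y)))
  = (2 * P - 2 * k) ^+ 2 + 4 * (2 * k) * P * (1 - Q).
  rewrite !sin_pi6D -[2 * _ * _]mulrA [2 * _]mulrC -[_ * 2 * _]mulrA /k !cos_pi3D /P /Q.
  rewrite (_ : 2 * e - (x + y) = (e - x) + (e - y)); last lra.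
  rewrite (_ : x + y - e = x - (e - y)); last lra.
  rewrite !(sinB, cosB, sinD, cosD).
  by ring: sqrt3_sqr (cos2sin2 x) (cos2sin2 y) (cos2sin2 e).
have k0 : 0 <= k by apply: cos_ge0_pihalf; lra.
have Pe : cos e <= P by rewrite /P -(cos_norm (x + y - e)) ler_cos // ?ler_norml; lra.
have Q1 : Q <= 1 by exact: cos_le1.
have ce0 : 0 <= cos e by apply: cos_ge0_pihalf; lra.
have -> : 2 * sin (pi / 6 + e) = 2 * cos e - 2 * k.
  by rewrite /k cos_pi3D sin_pi6D; lra.
have ke : k <= cos e by apply: ler_cos; lra.
have : 0 <= 4 * (2 * k) * P * (1 - Q) by rewrite !mulr_ge0 //; lra.
have : (2 * cos e - 2 * k) ^+ 2 <= (2 * P - 2 * k) ^+ 2 by rewrite ler_sqr ?nnegrE; lra.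
lra.
Qed.

End Trigonometry.

(** * Angles of triangles with sides in [[1, rho]] *)

Section Angles.
Variable R : realType.
Implicit Types a b c e p q t rho gamma beta : R.

Definition potential a : R := asin (a / 2) - pi / 6.

Lemma potentialK a : -2 <= a <= 2 -> 2 * sin (pi / 6 + potential a) = a.
Proof.
by move=> ha; rewrite /potential addrC subrK asinK; [lra|rewrite in_itv /=; lra].
Qed.

Lemma potential_ge0 a : 1 <= a <= 2 -> 0 <= potential a.
Proof.
move=> ha; have pi0 := pi_gt0 R; have aR : -1 <= a / 2 <= 1 by lra.
have l1 := asin_geNpi2 aR; have l2 := asin_lepi2 aR.
rewrite leNgt; apply/negP; rewrite subr_lt0 -ltr_sin ?in_itv /=; try lra.
by rewrite asinK ?in_itv /= // sin_pi6; lra.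
Qed.

Lemma potential_le a e : 1 <= a <= 2 -> 0 <= e <= pi / 3 ->
  a <= 2 * sin (pi / 6 + e) -> potential a <= e.
Proof.
move=> ha he; have pi0 := pi_gt0 R; have aR : -1 <= a / 2 <= 1 by lra.
have l1 := asin_geNpi2 aR; have l2 := asin_lepi2 aR.
rewrite -[X in X <= _]potentialK; last lra.
rewrite ler_pM2l // !leNgt => /negP h; apply/negP => h1; apply: h.
by rewrite ltr_sin ?in_itv /= /potential; move: h1; rewrite /potential; lra.
Qed.

(** With two sides fixed, the third side grows with the angle opposite to it. *)
Lemma cos_law_angle_le a b beta gamma : 0 < a -> 0 < b ->
  0 <= beta <= pi -> 0 <= gamma <= pi ->
  a ^+ 2 + b ^+ 2 - 2 * a * b * cos beta <= a ^+ 2 + b ^+ 2 - 2 * a * b * cos gamma ->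
  beta <= gamma.
Proof.
move=> a0 b0 hb hg h; rewrite leNgt -ltr_cos ?in_itv //= -leNgt.
have ab0 : 0 < a * b by rewrite mulr_gt0.
nra.
Qed.

(** At the lower angle the third side would be at most 1 by [cos_law_le1], at the upper one at least
    [rho] by [cos_law_ge]. *)
Lemma angle_bounds e a b gamma (rho := 2 * sin (pi / 6 + e)) :
  0 <= e <= pi / 12 -> 1 <= a <= rho -> 1 <= b <= rho -> 0 <= gamma <= pi ->
  1 <= a ^+ 2 + b ^+ 2 - 2 * a * b * cos gamma <= rho ^+ 2 ->
  pi / 3 - (potential a + potential b) <= gamma
    <= pi / 3 + (2 * e - (potential a + potential b)).
Proof.
move=> he ha hb hg /andP[h1 h2]; have pi0 := pi_gt0 R.
have rho2 : rho <= 2 by have := sin_le1 (pi / 6 + e); rewrite /rho; lra.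
have xa : 0 <= potential a by apply: potential_ge0; lra.
have xb : 0 <= potential b by apply: potential_ge0; lra.
have ya : potential a <= e by apply: potential_le; rewrite -?/rho; lra.
have yb : potential b <= e by apply: potential_le; rewrite -?/rho; lra.
have aE : 2 * sin (pi / 6 + potential a) = a by apply: potentialK; lra.
have bE : 2 * sin (pi / 6 + potential b) = b by apply: potentialK; lra.
apply/andP; split; apply: (@cos_law_angle_le a b); try lra; last first.
  apply: le_trans h2 _; rewrite /rho.
  by have := @cos_law_ge R e (potential a) (potential b); rewrite aE bE; apply; lra.
apply: le_trans h1.
by have := @cos_law_le1 R (potential a) (potential b); rewrite aE bE; apply; lra.
Qed.

(** A convex quadratic lies below its chord on [[1, rho]]. *)
Lemma quad_lt1 a rho p q : 1 <= a <= rho -> 1 + p + q < 1 -> rho ^+ 2 + p * rho + q < 1 ->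
  a ^+ 2 + p * a + q < 1.
Proof.
move=> /andP[a1 ar] h1 h2.
have : a ^+ 2 <= (1 + rho) * a - rho by nra.
have [h|h] := leP 0 (1 + rho + p); nra.
Qed.

(** The expression is convex in [a] and in [b]. The first three hypotheses give the bound at the
    corners [(1, 1)], [(1, rho)] and [(rho, rho)], in this order. *)
Lemma cos_law_lt1 rho a b c : 1 / 2 < c -> rho < 2 * c -> 2 * rho ^+ 2 * (1 - c) < 1 ->
  1 <= a <= rho -> 1 <= b <= rho -> a ^+ 2 + b ^+ 2 - 2 * a * b * c < 1.
Proof.
move=> c2 rc h ha hb; have hr : 0 < rho * (2 * c - rho) by rewrite mulr_gt0; lra.
have -> : a ^+ 2 + b ^+ 2 - 2 * a * b * c = a ^+ 2 + - (2 * b * c) * a + b ^+ 2 by ring.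
apply: quad_lt1 ha _ _.
  have -> : 1 + - (2 * b * c) + b ^+ 2 = b ^+ 2 + - (2 * c) * b + 1 by ring.
  by apply: quad_lt1 hb _ _; nra.
have -> : rho ^+ 2 + - (2 * b * c) * rho + b ^+ 2
  = b ^+ 2 + - (2 * c * rho) * b + rho ^+ 2 by ring.
by apply: quad_lt1 hb _ _; nra.
Qed.

(* [angle_bounds] alone would only give [pi / 3 - 2 e <= gamma] here; convexity
   in each side reduces this sharper bound to the corners of [[1, rho]^2]. *)
Lemma angle_gt n rho a b gamma : 7 <= n -> 1 <= a <= rho -> 1 <= b <= rho ->
  rho < 2 * sin (pi / 6 * (n / (n - 1))) -> 0 <= gamma <= pi ->
  1 <= a ^+ 2 + b ^+ 2 - 2 * a * b * cos gamma ->
  pi / 3 - pi / 3 / n < gamma.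
Proof.
move=> n7 ha hb hr hg h1; have pi0 := pi_gt0 R.
have n0 : n != 0 by rewrite gt_eqF //; lra.
have n1 : n - 1 != 0 by rewrite gt_eqF //; lra.
pose y : R := pi / 6 / n; pose x : R := pi / 6 / (n - 1).
have yE : y * n = pi / 6 by rewrite /y; field.
have xE : x * (n - 1) = pi / 6 by rewrite /x; field.
have y0 : 0 < y by nra.
have x0 : 0 < x by nra.
have xy : x < 2 * y by nra.
have y1 : y <= pi / 42 by nra.
rewrite (_ : pi / 3 / n = 2 * y); last by rewrite /y; field.
have hrx : rho < 2 * sin (pi / 6 + x).
  by rewrite (_ : pi / 6 + x = pi / 6 * (n / (n - 1))) // /x; field.
have prod := mul_sin_pi6_le1 _ _ n7.
have hb2 : pi / 6 * ((n - 1) / n) = (pi / 3 - 2 * y) / 2 by rewrite /y; field.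
rewrite ltNge; apply/negP => hle.
suff : a ^+ 2 + b ^+ 2 - 2 * a * b * cos (pi / 3 - 2 * y) < 1.
  have : cos (pi / 3 - 2 * y) <= cos gamma by apply: ler_cos; lra.
  have : 0 < a * b by nra.
  nra.
apply: (@cos_law_lt1 rho) => //.
- by rewrite -(cos_pi3 R) ltr_cos ?in_itv /=; lra.
(* Here [sin (pi / 6 + x) = cos (pi / 3 - x)] and [x < 2 y]. *)
- apply: lt_trans hrx _; rewrite -cosBpihalf -cosN ltr_pM2l // ltr_cos ?in_itv /=; lra.
(* The left-hand side is [(2 rho s)^2], and [2 rho s < 4 S s <= 1] by [prod]. *)
- move: prod; rewrite cos_half hb2; set s := sin (_ / 2) => prod.
  have s0 : 0 < s by apply: sin_gt0_pi; lra.
  move: hr prod; set S := sin _ => hr prod.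
  have w1 : 2 * rho * s < 1 by nra.
  have w0 : 0 < 2 * rho * s by rewrite !mulr_gt0 //; lra.
  have : (2 * rho * s) ^+ 2 < 1 by move: (2 * rho * s) w0 w1 => w; nra.
  by rewrite !exprMn; lra.
Qed.

End Angles.

(** * Signed angles between complex numbers *)

Section Turns.
Variable R : realType.
Implicit Types z w : R[i].
Local Notation Re := (@complex.Re R).
Local Notation Im := (@complex.Im R).

(** The norm on [R[i]] takes its values in [R[i]]; the angles need a real one. *)
Definition modulus z : R := Num.sqrt (Re z ^+ 2 + Im z ^+ 2).

Lemma normE z : `|z| = (modulus z)%:C%C.
Proof. exact: normc_def. Qed.

Lemma modulus_sqr z : modulus z ^+ 2 = Re z ^+ 2 + Im z ^+ 2.
Proof. by rewrite sqr_sqrtr // addr_ge0 // sqr_ge0. Qed.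

(** This and [angle_sin] are the real and imaginary parts of [w] times the conjugate of [z], divided
    by the moduli. *)
Definition angle_cos z w := (Re w * Re z + Im w * Im z) / (modulus z * modulus w).
Definition angle_sin z w := (Im w * Re z - Re w * Im z) / (modulus z * modulus w).
Definition angle z w : R := acos (angle_cos z w).
Definition clockwise z w : bool := angle_sin z w < 0.
(** For nonzero [z] and [w], the angle from [z] to [w] in [(-pi, pi]]. Its sign is kept as a boolean
    so that sign changes can be counted. *)
Definition turn z w : R := (-1) ^+ clockwise z w * angle z w.
Definition expi (t : R) : R[i] := (cos t +i* sin t)%C.

Lemma expiD (s t : R) : expi (s + t) = expi s * expi t.
Proof. by rewrite /expi cosD sinD; congr (_ +i* _)%C; ring. Qed.

(** Lagrange's identity in dimension two, once the moduli are cleared. *)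
Lemma angle_cos2Dsin2 z w : 0 < modulus z -> 0 < modulus w ->
  angle_cos z w ^+ 2 + angle_sin z w ^+ 2 = 1.
Proof.
move=> z0 w0; rewrite /angle_cos /angle_sin.
have -> : forall c s m : R, (c / m) ^+ 2 + (s / m) ^+ 2 = (c ^+ 2 + s ^+ 2) / m ^+ 2.
  by move=> c s m; rewrite !expr_div_n mulrDl.
rewrite [(modulus z * _) ^+ 2]exprMn !modulus_sqr.
apply: (canLR (mulfK _)); last by ring.
by rewrite -!modulus_sqr mulf_neq0 // expf_neq0 // gt_eqF.
Qed.

Section Step.
Variables z w : R[i].
Hypotheses (z0 : 0 < modulus z) (w0 : 0 < modulus w).

Let cosR : -1 <= angle_cos z w <= 1.
Proof. by have := angle_cos2Dsin2 _ _ z0 w0; nra. Qed.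

Lemma angle_ge0_le_pi : 0 <= angle z w <= pi.
Proof. by rewrite /angle acos_ge0 ?acos_lepi. Qed.

Lemma cos_angle : cos (angle z w) = angle_cos z w.
Proof. by rewrite /angle acosK // in_itv. Qed.

Lemma sin_turn : sin (turn z w) = angle_sin z w.
Proof.
have sE : sin (angle z w) = `|angle_sin z w|.
  rewrite /angle sin_acos // -sqrtr_sqr; congr Num.sqrt.
  by have := angle_cos2Dsin2 _ _ z0 w0; lra.
rewrite /turn /clockwise; case: ltP => h.
  by rewrite expr1 mulN1r sinN sE ltr0_norm // opprK.
by rewrite expr0 mul1r sE ger0_norm.
Qed.

Lemma cos_turn : cos (turn z w) = angle_cos z w.
Proof.
by rewrite -cos_angle /turn; case: clockwise; rewrite ?expr1 ?mulN1r ?cosN // expr0 mul1r.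
Qed.

Lemma rotation_step : w * (modulus z)%:C%C = z * (modulus w)%:C%C * expi (turn z w).
Proof.
have m0 : modulus z * modulus w != 0 by rewrite mulf_neq0 // gt_eqF.
have zne : modulus z != 0 by rewrite gt_eqF.
have wne : modulus w != 0 by rewrite gt_eqF.
have sq := modulus_sqr z.
rewrite /expi cos_turn sin_turn /angle_cos /angle_sin; move: sq zne wne.
case: z w => [zr zi] [wr wi] /=; set a := modulus _; set b := modulus _.
move=> sq zne wne; apply/eqP; rewrite eq_complex /=; apply/andP; split; apply/eqP.
  transitivity (wr * (a ^+ 2) / a); first by field.
  by rewrite sq; field; rewrite ?zne ?wne.
transitivity (wi * (a ^+ 2) / a); first by field.
by rewrite sq; field; rewrite ?zne ?wne.
Qed.

Lemma cos_law : modulus (w - z) ^+ 2 = modulus z ^+ 2 + modulus w ^+ 2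
  - 2 * modulus z * modulus w * cos (angle z w).
Proof.
have zne : modulus z != 0 by rewrite gt_eqF.
have wne : modulus w != 0 by rewrite gt_eqF.
rewrite cos_angle /angle_cos.
have -> : 2 * modulus z * modulus w *
   ((Re w * Re z + Im w * Im z) / (modulus z * modulus w))
   = 2 * (Re w * Re z + Im w * Im z) by field; rewrite ?zne ?wne.
rewrite !modulus_sqr; case: z w => [? ?] [? ?] /=; ring.
Qed.

End Step.

(** The steps [rotation_step] telescope: the modulus of each intermediate point cancels. *)
Lemma rotation_prod (X : nat -> R[i]) n : (forall i, 0 < modulus (X i)) ->
  X n * (modulus (X 0))%:C%C
    = X 0 * (modulus (X n))%:C%C * expi (\sum_(i < n) turn (X i) (X i.+1)).
Proof.
move=> X0; elim: n => [|n IH].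
  by rewrite big_ord0 /expi cos0 sin0 mulr1.
rewrite big_ord_recr /= expiD.
have mn : (modulus (X n))%:C%C != 0 :> R[i].
  by rewrite eq_complex /= eqxx andbT gt_eqF.
apply: (mulfI mn); have := rotation_step _ _ (X0 n) (X0 n.+1) => st.
transitivity (X n.+1 * (modulus (X n))%:C%C * (modulus (X 0))%:C%C); first by ring.
rewrite st.
transitivity (X n * (modulus (X 0))%:C%C * (modulus (X n.+1))%:C%C
  * expi (turn (X n) (X n.+1))); first by ring.
by rewrite IH; ring.
Qed.

Lemma closed_turn_sum (X : nat -> R[i]) n : (forall i, 0 < modulus (X i)) ->
  X n = X 0 -> cos (\sum_(i < n) turn (X i) (X i.+1)) = 1.
Proof.
move=> Xp Xn; have := rotation_prod X n Xp; rewrite Xn.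
have X0 : X 0 * (modulus (X 0))%:C%C != 0.
  rewrite mulf_neq0 //; last by rewrite eq_complex /= eqxx andbT gt_eqF.
  apply: contraTneq (Xp 0) => ->.
  by rewrite -leNgt /modulus /= expr0n /= addr0 sqrtr0.
by rewrite -[LHS]mulr1 => /(mulfI X0) [].
Qed.

End Turns.

(** * Sums with signs around a cycle *)

Section CyclicSums.
Variable R : realType.

Lemma sign_changes_parity (s : nat -> bool) n :
  odd (\sum_(i < n) (s i != s i.+1))%N = (s 0%N != s n).
Proof.
elim: n => [|n IH]; first by rewrite big_ord0 eqxx.
by rewrite big_ord_recr /= oddD IH; case: (s 0%N) (s n) (s n.+1) => [] [] [].
Qed.

Lemma no_sign_change (s : nat -> bool) n :
  (\sum_(i < n) (s i != s i.+1) = 0)%N -> forall i, (i <= n)%N -> s i = s 0%N.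
Proof.
move=> /eqP; rewrite sum_nat_eq0 => /forallP h; elim=> [//|i IH] lin.
rewrite -IH; last exact: ltnW.
by have := h (Ordinal lin); rewrite /= eqb0 negbK => /eqP.
Qed.

(** In a closed sequence the number of changes is even, and here it is not 0. *)
Lemma sign_changes_ge2 (s : nat -> bool) n : s n = s 0%N ->
  (exists2 i, (i <= n)%N & s i != s 0%N) -> (2 <= \sum_(i < n) (s i != s i.+1))%N.
Proof.
move=> sn [i lin si]; have := sign_changes_parity s n; rewrite sn eqxx.
have := no_sign_change s n.
by case: (\sum_(i < n) _)%N => [|[|//]] // /(_ erefl i lin) e; rewrite e eqxx in si.
Qed.

Lemma cyclic_shift_sum (F : nat -> R) n : F n = F 0%N ->
  \sum_(i < n) F i.+1 = \sum_(i < n) F i.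
Proof.
move=> Fn; apply: (addrI (F 0%N)); rewrite -(big_ord_recl n (fun i => F i)).
by rewrite big_ord_recr /= Fn addrC.
Qed.

(** Summation by parts gives [q i.+1] a coefficient that vanishes at a sign change and is 2 or -2
    elsewhere; at least two terms vanish. *)
Lemma cyclic_signed_sum_le (s : nat -> bool) (q : nat -> R) (k : R) n :
  s n = s 0%N -> q n = q 0%N -> (forall i, `|q i| <= k) ->
  (exists2 i, (i <= n)%N & s i != s 0%N) ->
  `|\sum_(i < n) (-1) ^+ s i * (q i + q i.+1)| <= 2 * k * (n%:R - 2).
Proof.
move=> sn qn qk ns; have c2 := sign_changes_ge2 _ _ sn ns.
have k0 : 0 <= k by apply: le_trans (qk 0%N).
have -> : \sum_(i < n) (-1) ^+ s i * (q i + q i.+1)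
  = \sum_(i < n) ((-1) ^+ s i + (-1) ^+ s i.+1) * q i.+1.
  under eq_bigr do rewrite mulrDr; rewrite big_split /=.
  rewrite -(@cyclic_shift_sum (fun i => (-1) ^+ s i * q i)) ?sn ?qn //=.
  by rewrite -big_split /=; apply: eq_bigr => i _; ring.
apply: le_trans (ler_norm_sum _ _ _) _.
apply: (@le_trans _ _ (\sum_(i < n) (2 * k - 2 * k * (s i != s i.+1)%:R))).
  apply: ler_sum => i _; rewrite normrM; have := qk i.+1.
  case: (s i) (s i.+1) => [] [] /=; rewrite ?expr1 ?expr0 ?addNr ?subrr ?normr0 ?mulr0n ?mulr1n; try lra.
  - by rewrite -opprD normrN [`|1 + 1|]ger0_norm; lra.
  - by rewrite [`|1 + 1|]ger0_norm; lra.
rewrite sumrB sumr_const card_ord -mulr_sumr -natr_sum -[_ *+ n]mulr_natr.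
have : 2 <= (\sum_(i < n) (s i != s i.+1))%:R :> R by rewrite (ler_nat R 2).
nra.
Qed.

End CyclicSums.

(** * Closed walks of odd length in an annulus *)

Section ClosedWalk.
Variable R : realType.

Lemma cos_neq1 (x : R) : 0 < x < 2 * pi -> cos x != 1.
Proof.
move=> hx; have := cos_half _ x.
have : 0 < sin (x / 2) by apply: sin_gt0_pi; lra.
move=> s0 h; apply/eqP => h1; rewrite h1 subrr in h; nra.
Qed.

Lemma cosDpi3n (t : R) n : cos (t + pi / 3 * n%:R) = cos (t + pi / 3 * (n %% 6)%:R).
Proof.
rewrite {1}(divn_eq n 6) natrD natrM.
rewrite -[RHS](periodicn (@cosD2pi R) (n %/ 6)); congr cos.
by rewrite -mulr_natl -[pi *+ 2]mulr_natr; lra.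
Qed.

Variables (X : nat -> R[i]) (g : nat) (e : R).
Let rho := 2 * sin (pi / 6 + e).
Hypotheses (g3 : (3 <= g)%N) (oddg : odd g) (he : 0 <= e <= pi / 12).
Hypotheses (Xg : X g = X 0) (Xg1 : X g.+1 = X 1).
Hypothesis X_bounds : forall i, 1 <= modulus _ (X i) <= rho.
Hypothesis diff_bounds : forall i, 1 <= modulus _ (X i.+1 - X i) <= rho.

Let gam i := angle R (X i) (X i.+1).
Let s i := clockwise R (X i) (X i.+1).
(** Centred potentials: they have size at most [e / 2], and [gam i - pi / 3 - (q i + q i.+1)] ranges
    over the symmetric interval [[-e, e]]. *)
Let q i := e / 2 - potential R (modulus R (X i)).

Let Xp i : 0 < modulus R (X i).
Proof. by have := X_bounds i; lra. Qed.

Let rho2 : rho <= 2.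
Proof. by have := sin_le1 (pi / 6 + e); rewrite /rho; lra. Qed.

Let gamR i : 0 <= gam i <= pi.
Proof. exact: angle_ge0_le_pi. Qed.

Let law i : 1 <= modulus R (X i) ^+ 2 + modulus R (X i.+1) ^+ 2
  - 2 * modulus R (X i) * modulus R (X i.+1) * cos (gam i) <= rho ^+ 2.
Proof.
rewrite -cos_law //; have := diff_bounds i; move: (modulus _ _) => m /andP[m1 m2].
by apply/andP; split; [nra|rewrite ler_sqr ?nnegrE //; lra].
Qed.

Let q_bound i : `|q i| <= e / 2.
Proof.
have pi0 := pi_gt0 R; have he1 := he; have hX := X_bounds i; have r2 := rho2.
have p0 : 0 <= potential R (modulus R (X i)) by apply: potential_ge0; lra.
have p1 : potential R (modulus R (X i)) <= e by apply: potential_le; [lra|lra|have /andP[] := hX].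
by rewrite ler_norml /q; lra.
Qed.

Let gam_bound i : `|gam i - pi / 3 - (q i + q i.+1)| <= e.
Proof.
have := angle_bounds _ _ _ _ _ he (X_bounds i) (X_bounds i.+1) (gamR i) (law i).
by rewrite ler_norml /q; lra.
Qed.

Let gam_q_sum : `|\sum_(i < g) (-1) ^+ s i * (gam i - pi / 3 - (q i + q i.+1))| <= g%:R * e.
Proof.
apply: le_trans (ler_norm_sum _ _ _) _.
apply: (@le_trans _ _ (\sum_(i < g) e)); last by rewrite sumr_const card_ord mulr_natl.
apply: ler_sum => i _.
by rewrite normrMsign.
Qed.

Let turn_sum : cos (\sum_(i < g) (-1) ^+ s i * gam i) = 1.
Proof. exact: closed_turn_sum. Qed.

(** The deviation is at most [g e] from [gam_q_sum] plus [(g - 2) e] from the potentials. Below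
    [pi / 3] it could not carry an odd multiple of [pi / 3] to a multiple of [2 pi]. *)
Lemma closed_walk_mixed : (exists2 i, (i <= g)%N & s i != s 0%N) ->
  pi / 3 <= 2 * (g%:R - 1) * e.
Proof.
move=> ns; have pi0 := pi_gt0 R; have he1 := he; rewrite leNgt; apply/negP => small.
have sg : s g = s 0%N by rewrite /s Xg Xg1.
have qg : q g = q 0%N by rewrite /q Xg.
have qs := cyclic_signed_sum_le R s q (e / 2) g sg qg q_bound ns.
set t := \sum_(i < g) (-1) ^+ s i * (gam i - pi / 3).
have tb : `|t| < pi / 3.
  apply: le_lt_trans small.
  have -> : t = \sum_(i < g) (-1) ^+ s i * (gam i - pi / 3 - (q i + q i.+1))
     + \sum_(i < g) (-1) ^+ s i * (q i + q i.+1).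
    by rewrite -big_split /=; apply: eq_bigr => i _; ring.
  apply: le_trans (ler_normD _ _) _.
  by have := lerD gam_q_sum qs; lra.
(* The number of clockwise turns, so that the signs add up to [g - 2 m]. *)
pose m := (\sum_(i < g) s i)%N.
have sumE : \sum_(i < g) (-1) ^+ s i * gam i = t + pi / 3 * (g%:R - 2 * m%:R).
  have -> : g%:R - 2 * m%:R = \sum_(i < g) (-1) ^+ s i :> R.
    rewrite /m natr_sum mulr_sumr -[g in g%:R]card_ord -sumr_const -sumrB.
    by apply: eq_bigr => i _; case: (s i); rewrite /= ?expr1 ?expr0 ?mulr1n ?mulr0n; lra.
  by rewrite mulr_sumr -big_split /=; apply: eq_bigr => i _; ring.
have := turn_sum; rewrite sumE.
(* Adding [m] full turns replaces [g - 2 m] by the natural number [g + 4 m], which is still odd. *)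
rewrite -(periodicn (@cosD2pi R) m).
have -> : t + pi / 3 * (g%:R - 2 * m%:R) + pi *+ 2 *+ m = t + pi / 3 * (g + 4 * m)%:R.
  by rewrite natrD natrM -mulr_natl -[pi *+ 2]mulr_natr; lra.
rewrite cosDpi3n; apply/eqP/cos_neq1; move: tb; rewrite ltr_norml.
have : ((g + 4 * m) %% 6 \in [:: 1; 3; 5])%N by rewrite !inE; lia.
by rewrite !inE => /or3P[] /eqP ->; lra.
Qed.

(** A common sign factors out of the sum, and the cosine is even. *)
Lemma closed_walk_unmixed : (forall i, (i <= g)%N -> s i = s 0%N) ->
  cos (\sum_(i < g) (gam i - pi / 3) + pi / 3 * (g %% 6)%:R) = 1.
Proof.
move=> cs; rewrite -cosDpi3n -[RHS]turn_sum.
have -> : \sum_(i < g) (-1) ^+ s i * gam i = (-1) ^+ s 0%N * \sum_(i < g) gam i.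
  by rewrite mulr_sumr; apply: eq_bigr => i _; rewrite cs // ltnW.
have -> : \sum_(i < g) (gam i - pi / 3) + pi / 3 * g%:R = \sum_(i < g) gam i.
  by rewrite sumrB sumr_const card_ord mulr_natr subrK.
by case: (s 0%N); rewrite ?expr1 ?mulN1r ?cosN // expr0 mul1r.
Qed.

Let unmixed_bound : `|\sum_(i < g) (gam i - pi / 3)| <= 2 * g%:R * e.
Proof.
apply: le_trans (ler_norm_sum _ _ _) _.
apply: (@le_trans _ _ (\sum_(i < g) (2 * e))).
  2: by rewrite sumr_const card_ord -mulr_natr; lra.
apply: ler_sum => i _.
have := gam_bound i; have := q_bound i; have := q_bound i.+1.
by rewrite !ler_norml; lra.
Qed.

(** If all signs agree, a deviation below [pi / 3] from [5 pi / 3] stays strictly between 0 and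
    [2 pi]. *)
Lemma closed_walk_defect5 : (g %% 6 = 5)%N -> pi / 6 / g%:R <= e.
Proof.
move=> g5; have pi0 := pi_gt0 R; have he1 := he; rewrite leNgt; apply/negP => small.
have g0 : 3 <= g%:R :> R by rewrite (ler_nat R 3).
have small' : 2 * g%:R * e < pi / 3.
  by move: small; rewrite ltr_pdivlMr; lra.
have [/existsP[i si]|/existsPn h] := boolP [exists i : 'I_g, s i != s 0%N].
  have := closed_walk_mixed (ex_intro2 _ _ (i : nat) (ltnW (ltn_ord i)) si).
  by lra.
have cs i : (i <= g)%N -> s i = s 0%N.
  rewrite leq_eqVlt => /orP[/eqP->|lig]; first by rewrite /s Xg Xg1.
  by have := h (Ordinal lig); rewrite negbK => /eqP.
have := closed_walk_unmixed cs; rewrite g5; apply/eqP/cos_neq1.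
by have := unmixed_bound; rewrite ler_norml; lra.
Qed.

(** If all signs agree, residue 3 starts from [pi], which tolerates any deviation below [pi].
    Residue 1 starts from [pi / 3], so a deviation of [- pi / 3] or less has to be excluded, by
    [angle_gt]. *)
Lemma closed_walk_defect13 : (g %% 6 = 1)%N \/ (g %% 6 = 3)%N -> pi / 6 / (g%:R - 1) <= e.
Proof.
move=> g13; have pi0 := pi_gt0 R; have he1 := he; rewrite leNgt; apply/negP => small.
have g0 : 3 <= g%:R :> R by rewrite (ler_nat R 3).
have small' : 2 * (g%:R - 1) * e < pi / 3.
  by move: small; rewrite ltr_pdivlMr; lra.
have [/existsP[i si]|/existsPn h] := boolP [exists i : 'I_g, s i != s 0%N].
  have := closed_walk_mixed (ex_intro2 _ _ (i : nat) (ltnW (ltn_ord i)) si).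
  by lra.
have cs i : (i <= g)%N -> s i = s 0%N.
  rewrite leq_eqVlt => /orP[/eqP->|lig]; first by rewrite /s Xg Xg1.
  by have := h (Ordinal lig); rewrite negbK => /eqP.
have := closed_walk_unmixed cs; apply/eqP/cos_neq1.
(* Compared with [small'], the extra [2 e] is at most [pi / 6]. *)
have ub : 2 * g%:R * e < pi by lra.
have := unmixed_bound; rewrite ler_norml => tb.
case: g13 => [g1|->]; last by lra.
rewrite g1.
have g7 : 7 <= g%:R :> R by rewrite (ler_nat R 7); lia.
have gn0 : g%:R != 0 :> R by rewrite gt_eqF //; lra.
have gn1 : g%:R - 1 != 0 :> R by rewrite gt_eqF //; lra.
have rs : rho < 2 * sin (pi / 6 * (g%:R / (g%:R - 1))).
  have -> : pi / 6 * (g%:R / (g%:R - 1)) = pi / 6 + pi / 6 / (g%:R - 1) :> R by field.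
  have x12 : pi / 6 / (g%:R - 1) <= pi / 12 :> R by rewrite ler_pdivrMr; nra.
  by rewrite ltr_pM2l // ltr_sin ?in_itv /=; lra.
have lb : - (pi / 3) < \sum_(i < g) (gam i - pi / 3).
  rewrite [ltLHS](_ : _ = \sum_(i < g) (- (pi / 3 / g%:R))); last first.
    by rewrite sumr_const card_ord -mulr_natr; field.
  apply: ltr_sum; first by apply/hasP; exists (Ordinal (ltnW (ltnW g3))); rewrite ?mem_index_enum.
  move=> i _; have /andP[l1 _] := law i.
  by have := angle_gt _ _ _ _ _ _ g7 (X_bounds i) (X_bounds i.+1) rs (gamR i) l1; lra.
by lra.
Qed.

End ClosedWalk.

(** * Flow values along a cycle of a cubic graph *)

Section Flow.
Variables (R : realType) (G : multigraph) (r : R).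
Variables (o : gE G -> bool) (phi : gE G -> R[i]).
Hypothesis flow : complex_nz_flow r o phi.

(** Half-edges are used so that a loop occurs twice at its vertex, as in [degree]. *)
Definition half_end (h : gE G * bool) : gV G := if h.2 then end1 h.1 else end2 h.1.

(* Flow leaving [half_end h] along the edge [h.1]. *)
Definition half_flow (h : gE G * bool) : R[i] :=
  if o h.1 == h.2 then phi h.1 else - phi h.1.

Lemma half_flow_swap e b : half_flow (e, ~~ b) = - half_flow (e, b).
Proof. by rewrite /half_flow /=; case: (o e) b => [] []; rewrite /= ?opprK. Qed.

Lemma half_flow_bounds h : 1 <= modulus R (half_flow h) <= r - 1.
Proof.
have [/(_ h.1) + _] := flow.
have -> : `|phi h.1| = `|half_flow h| by rewrite /half_flow; case: ifP; rewrite ?normrN.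
by rewrite normE !lecR.
Qed.

Lemma half_flow_conservation v : \sum_(h | half_end h == v) half_flow h = 0.
Proof.
have [_ /(_ v) cons] := flow.
have -> : \sum_(h | half_end h == v) half_flow h
   = \sum_(e | tail o e == v) phi e - \sum_(e | Defs.head o e == v) phi e.
  rewrite big_mkcond /= -(pair_bigA _ (fun e b =>
     if half_end (e, b) == v then half_flow (e, b) else 0)) /=.
  rewrite [X in X - _]big_mkcond [X in _ - X]big_mkcond /= -sumrB.
  apply: eq_bigr => e _; rewrite big_bool /half_end /half_flow /tail /Defs.head /=.
  by case: (o e); do 2 (case: ifP => _); rewrite /= ?(addr0, add0r, subr0, sub0r, subrr, addNr).
by rewrite cons subrr.
Qed.

Lemma card_half_end v : #|[pred h | half_end h == v]| = degree v.
Proof.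
rewrite -sum1_card big_mkcond /= -(pair_bigA _ (fun e b =>
     if half_end (e, b) == v then 1 else 0)%N) /=.
rewrite /degree -!sum1_card [in RHS]big_mkcond [X in (_ + X)%N]big_mkcond /= -big_split /=.
by apply: eq_bigr => e _; rewrite big_bool /half_end /= !inE.
Qed.

(** Once [h1] and [h2] are removed, a single half-edge at [v] remains, and conservation determines
    its flow. *)
Lemma cubic_third_half v h1 h2 : degree v = 3%N -> half_end h1 = v -> half_end h2 = v ->
  h1 != h2 -> exists h3, half_flow h1 + half_flow h2 + half_flow h3 = 0.
Proof.
move=> dv e1 e2 n12; have := half_flow_conservation v; have := card_half_end v.
rewrite dv (cardD1 h1) inE e1 eqxx (cardD1 h2) !inE e2 eqxx eq_sym n12 /=.
move=> /eqP; rewrite !add1n !eqSS => /eqP /mem_card1 [h3 h3P] sum0.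
exists h3; rewrite -[RHS]sum0 (bigD1 h1) ?e1 ?eqxx //= (bigD1 h2) ?e2 ?eqxx 1?eq_sym //=.
rewrite -addrA; congr (_ + (_ + _)); rewrite -[LHS](@big_pred1_eq _ _ +%R _ h3 half_flow).
apply: eq_bigl => h; have := h3P h; rewrite !inE => <-.
by case: (half_end h == v) (h == h1) (h == h2) => [] [] [].
Qed.

Section Cycle.
Variables (g : nat) (vs : nat -> gV G) (es : nat -> gE G).
Hypotheses (Gcubic : cubic G) (g2 : (2 <= g)%N).
Hypothesis es_inj : forall i j, (i < g)%N -> (j < g)%N -> es i = es j -> i = j.
Hypothesis es_joins :
  forall i, (i < g)%N -> joins (es i) (vs i) (vs (i.+1 %% g)%N).

Let j i := (i %% g)%N.
Let jlt i : (j i < g)%N. Proof. by rewrite ltn_mod; lia. Qed.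

(** The half-edge by which the cycle leaves its [i]-th vertex; reduction modulo [g] makes the
    sequence periodic. *)
Definition cycle_half i := (es (j i), end1 (es (j i)) == vs (j i)).
Definition cycle_flow i := half_flow (cycle_half i).

Lemma cycle_half_start i : half_end (cycle_half i) = vs (j i).
Proof.
rewrite /half_end /cycle_half /=; case: eqP => // ne.
by have := es_joins _ (jlt i); rewrite /joins; case: eqP => //= _ /andP[_ /eqP].
Qed.

Lemma cycle_half_stop i :
  half_end ((cycle_half i).1, ~~ (cycle_half i).2) = vs (j i.+1).
Proof.
have -> : j i.+1 = ((j i).+1 %% g)%N by rewrite /j -[(i %% g).+1]addn1 modnDml addn1.
have := es_joins _ (jlt i); rewrite /half_end /cycle_half /joins /=.
case: eqP => /= [e1 /orP[/eqP //|/andP[/eqP <- /eqP ->]]|_ /andP[/eqP ->]] //.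
Qed.

(** At the common vertex the two half-edges of the cycle carry [cycle_flow i.+1] and
    [- cycle_flow i]; the third edge, read from its other end, carries the difference. *)
Lemma cycle_flow_diff i : exists h, cycle_flow i.+1 - cycle_flow i = half_flow h.
Proof.
(* Even the edges differ: [i] and [i.+1] are distinct modulo [g] because [2 <= g]. *)
have ne : cycle_half i.+1 != ((cycle_half i).1, ~~ (cycle_half i).2).
  apply/eqP => -[/(es_inj _ _ (jlt _) (jlt _)) + _]; rewrite /j => /eqP.
  by rewrite -addn1 -[X in _ == X %[mod _]]addn0 eqn_modDl mod0n modn_small.
have [h hP] := cubic_third_half _ _ _ (Gcubic _) (cycle_half_start i.+1) (cycle_half_stop i) ne.
exists (h.1, ~~ h.2); rewrite half_flow_swap -surjective_pairing.
move: hP; rewrite half_flow_swap -surjective_pairing -/(cycle_flow _).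
by move=> /eqP; rewrite addr_eq0 => /eqP.
Qed.

End Cycle.
End Flow.

(* phi_C(G) >= bound, stated as: every r for which G admits a complex
   nowhere-zero r-flow satisfies r >= bound (phi_C is the minimum of such r). *)
Theorem theorem2 (R : realType) (G : multigraph) (g : nat) :
  cubic G -> bridgeless G -> ~ bipartite G -> odd_girth G g ->
  forall r : R, admits_complex_flow G r ->
    (((g %% 6 == 1) || (g %% 6 == 3))%N ->
       1 + 2 * sin (pi / 6 * (g%:R / (g%:R - 1))) <= r) /\
    ((g %% 6 == 5)%N ->
       1 + 2 * sin (pi / 6 * ((g%:R + 1) / g%:R)) <= r).
Proof.
move=> Gcubic _ _ [oddg [_ [vs [es [_ es_inj es_joins]]]] _] r [r2 [o [phi flow]]].
have pi0 := pi_gt0 R.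
have [g1|g3] : g = 1%N \/ (3 <= g)%N by move: oddg; case: g {es_inj es_joins} => [|[|[|]]]; auto.
  (* The inverse of [g - 1 = 0] is 0, so the bound reads [1 + 2 sin 0 = 1]. *)
  by rewrite g1 subrr invr0 !mulr0 sin0; split=> // _; lra.
have g3R : 3 <= g%:R :> R by rewrite (ler_nat R 3).
(* Neither bound exceeds 3; for [r < 3] the length [r - 1] has a potential. *)
have [r3|r3] := lerP 3 r.
  by split=> _; set x := sin _; have : x <= 1 by [exact: sin_le1]; lra.
pose X := cycle_flow R G o phi g vs es.
pose e := potential R (r - 1).
have rhoE : 2 * sin (pi / 6 + e) = r - 1 by apply: potentialK; lra.
have e0 : 0 <= e by apply: potential_ge0; lra.
have e3 : e <= pi / 3 by have := @asin_lepi2 R ((r - 1) / 2); rewrite /e /potential; lra.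
have Xg : X g = X 0%N by rewrite /X /cycle_flow /cycle_half modnn mod0n.
have Xg1 : X g.+1 = X 1%N by rewrite /X /cycle_flow /cycle_half -addn1 modnDl.
have Xb i : 1 <= modulus R (X i) <= 2 * sin (pi / 6 + e).
  by rewrite rhoE; exact: half_flow_bounds.
have Xdb i : 1 <= modulus R (X i.+1 - X i) <= 2 * sin (pi / 6 + e).
  have [h] := cycle_flow_diff R G r o phi flow g vs es Gcubic (ltnW g3) es_inj es_joins i.
  by rewrite -/X rhoE => ->; exact: half_flow_bounds.
(* The closed-walk lemmas require [e <= pi / 12]. For larger [e] the bound is immediate, since both
   values of [d] are at most [pi / 12] when [g >= 3]. *)
have bound (d : R) : 0 <= d <= pi / 12 -> (e <= pi / 12 -> d <= e) ->
    1 + 2 * sin (pi / 6 + d) <= r.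
  move=> d12 de; have {}de : d <= e by case: (leP e (pi / 12)) => // h; lra.
  suff : sin (pi / 6 + d) <= sin (pi / 6 + e) by lra.
  by rewrite leNgt ltr_sin ?in_itv /= -?leNgt; lra.
split=> g6.
  rewrite (_ : pi / 6 * _ = pi / 6 + pi / 6 / (g%:R - 1)).
    2: by field; rewrite gt_eqF //; lra.
  apply: bound => [|e12]; first by rewrite divr_ge0 ?ler_pdivrMr /=; nra.
  apply: (closed_walk_defect13 _ X) => //; first by rewrite e0.
  by case/orP: g6 => /eqP; [left|right].
rewrite (_ : pi / 6 * _ = pi / 6 + pi / 6 / g%:R).
  2: by field; rewrite gt_eqF //; lra.
apply: bound => [|e12]; first by rewrite divr_ge0 ?ler_pdivrMr /=; nra.
by apply: (closed_walk_defect5 _ X) => //; [rewrite e0|apply/eqP].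
Qed.
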